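(* Let $P=(X,\prec)$ be a finite poset and let $x,y\in X$ be fixed elements. Let $f$ be a uniformly random linear extension of $P$, with $\mathbb{E}$ denoting expectation with respect to $f$. Then $$\frac{\mathbb{E}[f(x)\,f(y)]+\mathbb{E}\big[\min\{f(x),f(y)\}\big]}{\mathbb{E}[f(x)]\cdot\mathbb{E}[f(y)]}\ \le\ 2.$$
   Context: A linear extension of a poset $P=(X,\prec)$ with $|X|=n$ is a bijection $f:X\to\{1,\dots,n\}$ such that $u\prec v$ implies $f(u)<f(v)$. The random linear extension $f$ is chosen uniformly from the set of all linear extensions of $P$. *)

(* Defs.v *)
From HB Require Import structures.
From mathcomp Require Import all_boot all_order all_algebra.
Set Implicit Arguments.
Unset Strict Implicit.
Unset Printing Implicit Defensive.
Import Order.TTheory GRing.Theory Num.Theory.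
Local Open Scope ring_scope.

(* The bijection X -> {1, .., n} is stored 0-based, as a finite function       *)
(* g : X -> 'I_n; the actual value of the linear extension at x is            *)
(* lext_val g x = (g x).+1, in {1, .., n}.                                    *)
Definition linear_extension (d : Order.disp_t) (X : finPOrderType d)
    (g : {ffun X -> 'I_#|X|}) : bool :=
  [&& injectiveb g,
      [forall i : 'I_#|X|, exists u : X, g u == i] &
      [forall u : X, forall v : X, (u < v)%O ==> (g u < g v)%N]].

Definition linear_extensions (d : Order.disp_t) (X : finPOrderType d) :
    {set {ffun X -> 'I_#|X|}} :=
  [set g | linear_extension g].

Definition lext_val (d : Order.disp_t) (X : finPOrderType d)
    (g : {ffun X -> 'I_#|X|}) (x : X) : nat := (g x).+1.

Definition lext_expect (R : realFieldType) (d : Order.disp_t)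
    (X : finPOrderType d) (F : {ffun X -> 'I_#|X|} -> R) : R :=
  (\sum_(g in linear_extensions X) F g) / #|linear_extensions X|%:R.

(* Main.v *)
Require Import Defs.
From HB Require Import structures.
From mathcomp Require Import all_boot all_order all_algebra.
From mathcomp Require Import zify ring lra.
Set Implicit Arguments.
Unset Strict Implicit.
Unset Printing Implicit Defensive.
Import Order.TTheory GRing.Theory Num.Theory.
Local Open Scope nat_scope.

(** Let [a = f(x)], [b = f(y)], [u = E f(x)] and [v = E f(y)]. Taking
    expectations in [2uv(ab + min(a, b)) <= v^2 a(a + 1) + u^2 b(b + 1)] reduces
    the theorem to [E C(f(x) + 1, 2) <= (E f(x))^2], the case [j = 0] of the
    log-concavity in [j] of the rising moments [E C(f(x) + j - 1, j)].

    For an up-set [A] containing [x], let [P_j(A)] be the sum of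
    [C(f(x) + j - 1, j)] over the linear extensions of [A]; it counts the linear
    extensions of [A] with a chain of [j] new elements below [x]. Splitting
    according to the first element [m] gives
    [P_(j+1)(A) = P_j(A) + sum_(m != x) P_(j+1)(A - m)], so that
    [P_(j+2) P_j <= P_(j+1)^2] follows by induction on [A] as soon as the ratio
    [P_(j+1)(A) / P_j(A)] does not increase when a minimal element other than
    [x] is deleted; for [j = 0] this ratio is the mean of [f(x)].

    In terms of the number [e] of linear extensions, that monotonicity says
    [e(S - m) e(S - z) <= e(S) e(S - m - z)], where [S] is [A] with a new chain
    of [j + 1] elements below [x], and [z] is the bottom of that chain: a weak
    form of Fishburn's inequality. The order polynomials of the four up-sets
    satisfy the same inequality by the Ahlswede-Daykin theorem, and [e] is
    recovered from their leading coefficients. *)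

Lemma setD1_ind (T : finType) (P : {set T} -> Prop) :
  (forall A : {set T}, (forall m, m \in A -> P (A :\ m)) -> P A) ->
  forall A, P A.
Proof.
move=> stepP A; have [n] := ubnP #|A|; elim: n A => // n IHn A leAn.
by apply: stepP => m mA; apply: IHn; rewrite (cardsD1 m) mA in leAn.
Qed.

Lemma setD1C (T : finType) (A : {set T}) u v : A :\ u :\ v = A :\ v :\ u.
Proof. by rewrite !setDDl setUC. Qed.

Lemma imset_setD1 (aT rT : finType) (f : aT -> rT) (A : {set aT}) u :
  injective f -> f @: (A :\ u) = f @: A :\ f u.
Proof.
move=> f_inj; apply/setP => y; rewrite in_setD1; apply/imsetP/andP => [[v]|[]].
  by case/setD1P=> neq_v vA ->; rewrite (inj_eq f_inj) imset_f.
move=> neq_y /imsetP[v vA def_y]; exists v => //.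
by rewrite in_setD1 vA andbT -(inj_eq f_inj) -def_y.
Qed.

(** * The Ahlswede-Daykin inequality *)

Section AhlswedeDaykin.

Local Open Scope ring_scope.

Lemma Ahlswede_Daykin_bool (R : realDomainType) (a0 a1 b0 b1 c0 c1 d0 d1 : R) :
    0 <= a0 -> 0 <= a1 -> 0 <= b0 -> 0 <= b1 ->
    0 <= c0 -> 0 <= c1 -> 0 <= d0 -> 0 <= d1 ->
    a0 * b0 <= c0 * d0 -> a0 * b1 <= c1 * d0 ->
    a1 * b0 <= c1 * d0 -> a1 * b1 <= c1 * d1 ->
  (a0 + a1) * (b0 + b1) <= (c0 + c1) * (d0 + d1).
Proof.
move=> a0_ge0 a1_ge0 b0_ge0 b1_ge0 c0_ge0 c1_ge0 d0_ge0 d1_ge0 h00 h01 h10 h11.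
suff: a0 * b1 + a1 * b0 <= c1 * d0 + c0 * d1 by lra.
have prod_le : (a0 * b1) * (a1 * b0) <= (c1 * d0) * (c0 * d1).
  have -> : (a0 * b1) * (a1 * b0) = (a0 * b0) * (a1 * b1) by ring.
  have -> : (c1 * d0) * (c0 * d1) = (c0 * d0) * (c1 * d1) by ring.
  by rewrite ler_pM ?mulr_ge0.
have q_ge0 : 0 <= c0 * d1 by rewrite mulr_ge0.
have r_ge0 : 0 <= a0 * b1 by rewrite mulr_ge0.
have t_ge0 : 0 <= a1 * b0 by rewrite mulr_ge0.
move: (a0 * b1) (a1 * b0) (c1 * d0) (c0 * d1) => r t w q in h01 h10 prod_le
  q_ge0 r_ge0 t_ge0 *.
have [w_le0|w_gt0] := lerP w 0; first by lra.
rewrite -(ler_pM2l w_gt0).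
have : 0 <= (w - r) * (w - t) by rewrite mulr_ge0 ?subr_ge0.
by lra.
Qed.

Lemma big_subsetU1 (R : Type) (idx : R) (op : Monoid.com_law idx) (T : finType)
    (x : T) (E : {set T}) (F : {set T} -> R) : x \notin E ->
  \big[op/idx]_(U : {set T} | U \subset x |: E) F U =
  \big[op/idx]_(U : {set T} | U \subset E) op (F U) (F (x |: U)).
Proof.
move=> xE; have xU (U : {set T}) : U \subset E -> x \notin U.
  by move=> UE; apply: contra xE; apply: (subsetP UE).
rewrite big_split (bigID (fun U : {set T} => x \in U)) /= Monoid.mulmC.
congr (op _ _).
  by apply: eq_bigl => U; rewrite -{2}(setU1K xE) subsetD1.
rewrite (reindex_onto (fun U => x |: U) (fun U => U :\ x)) /=; last first.
  by move=> U /andP[_ xU']; rewrite setD1K.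
apply: eq_bigl => U; rewrite setU11 andbT; apply/andP/idP => [[UE /eqP <-]|UE].
  by rewrite -(setU1K xE) setSD.
by rewrite setUS // setU1K // xU.
Qed.

Theorem Ahlswede_Daykin (R : realDomainType) (T : finType)
    (a b c d : {set T} -> R) (E : {set T}) :
    (forall U, 0 <= a U) -> (forall U, 0 <= b U) ->
    (forall U, 0 <= c U) -> (forall U, 0 <= d U) ->
    (forall U V : {set T}, U \subset E -> V \subset E ->
       a U * b V <= c (U :|: V) * d (U :&: V)) ->
  (\sum_(U : {set T} | U \subset E) a U) *
  (\sum_(U : {set T} | U \subset E) b U)
  <= (\sum_(U : {set T} | U \subset E) c U) *
     (\sum_(U : {set T} | U \subset E) d U).
Proof.
elim/setD1_ind: E a b c d => E IHE a b c d a0 b0 c0 d0 abcd.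
have [E0|[x xE]] := set_0Vmem E.
  have sum0 F : \sum_(U : {set T} | U \subset E) F U = F set0 :> R.
    by rewrite (big_pred1 set0) // => U; rewrite E0 subset0.
  by have := abcd set0 set0; rewrite !sub0set setU0 setI0 !sum0; apply.
rewrite -(setD1K xE) !big_subsetU1 ?setD11 //=.
apply: IHE => // [U|U|U|U|U V UE VE]; rewrite ?addr_ge0 //.
have /subsetD1P[sU xU] := UE; have /subsetD1P[sV xV] := VE.
have disjx (W : {set T}) : x \notin W -> [set x] :&: W = set0.
  by rewrite -disjoints1 -setI_eq0 => /eqP.
have sxU : x |: U \subset E by rewrite subUset sub1set xE.
have sxV : x |: V \subset E by rewrite subUset sub1set xE.
apply: Ahlswede_Daykin_bool; rewrite ?abcd //.
- have := abcd _ _ sU sxV.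
  by rewrite setUCA setIUr [U :&: [set x]]setIC disjx // set0U.
- by have := abcd _ _ sxU sV; rewrite -setUA setIUl disjx // set0U.
- by have := abcd _ _ sxU sxV; rewrite setUACA setUid -setUIr.
Qed.

End AhlswedeDaykin.

(** * Powers and falling factorials *)

Lemma leq_exp2rW m n e : m <= n -> m ^ e <= n ^ e.
Proof. by case: e => // e le_mn; rewrite leq_exp2r. Qed.

Lemma leq_ffact_expn n k : n ^_ k <= n ^ k.
Proof.
elim: k n => [|k IHk] [|n] //; rewrite ?ffact0n // ffactSS expnS leq_mul //.
by rewrite (leq_trans (IHk n)) // leq_exp2rW.
Qed.

Lemma leq_expn_ffact n s k : k <= s -> n ^ k <= (n + s) ^_ k.
Proof.
elim: k s => // k IHk [//|s] le_ks.
by rewrite addnS ffactSS expnS leq_mul ?IHk // -addnS leq_addr.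
Qed.

Lemma leq_mul_fact k i j : (k + i)`! * (k + j)`! <= (k + i + j)`! * k`!.
Proof.
elim: j => [|j IHj]; first by rewrite !addn0.
by rewrite !addnS !factS mulnCA -mulnA leq_mul // ltnS leq_add2r leq_addr.
Qed.

Lemma leq_expS_Bernoulli n k : n.+1 ^ k.+1 <= n.+1 * n ^ k + k * n.+1 ^ k.
Proof.
elim: k => [|k IHk]; first by rewrite expn1 muln1 leq_addr.
rewrite expnS (leq_trans (leq_mul (leqnn n.+1) IHk)) //.
have : n ^ k <= n.+1 ^ k by rewrite leq_exp2rW.
by rewrite !expnS; nia.
Qed.

Lemma leq_of_leq_mul_expn p q b s :
  (forall M, p * M ^ s <= q * (M + b) ^ s) -> p <= q.
Proof.
case: b => [|b] le_pq.
  by have := le_pq 1; rewrite addn0 exp1n !muln1.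
have le_succ n : p * n ^ s <= q * n.+1 ^ s.
  have := le_pq (b.+1 * n); rewrite -mulnSr !expnMn mulnCA [leqRHS]mulnCA.
  by rewrite leq_pmul2l // expn_gt0.
rewrite leqNgt; apply/negP => lt_qp.
have := leq_mul (leqnn p) (leq_expS_Bernoulli (s * p) s).
have := leq_mul (leqnn (s * p).+1) (le_succ (s * p)).
have : 0 < (s * p).+1 ^ s by rewrite expn_gt0.
by rewrite expnS; nia.
Qed.

(** * Order polynomials and Fishburn's inequality *)

Section LinearExtensions.

Variables (d : Order.disp_t) (T : finPOrderType d).
Implicit Types (A B S U : {set T}) (m u v x z : T) (s : seq T).

Definition minimals A : {set T} := [set m in A | [forall v in A, ~~ (v < m)%O]].

Definition upset A := [forall u in A, forall v, (u < v)%O ==> (v \in A)].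

Lemma minimalsP A m :
  reflect (m \in A /\ forall v, v \in A -> ~~ (v < m)%O) (m \in minimals A).
Proof. by rewrite inE; apply: (iffP andP) => -[mA /forall_inP]. Qed.

Lemma minimals_sub A m : m \in minimals A -> m \in A.
Proof. by case/minimalsP. Qed.

Lemma card_setD1_minimals A m k :
  #|A| = k.+1 -> m \in minimals A -> #|A :\ m| = k.
Proof. by move=> + /minimals_sub mA; rewrite (cardsD1 m) mA => -[]. Qed.

Lemma minimals_setD1 A m u :
  m \in minimals A -> m != u -> m \in minimals (A :\ u).
Proof.
move=> /minimalsP[mA min_m] mu; apply/minimalsP; rewrite in_setD1 mu.
by split=> // v /setD1P[_ /min_m].
Qed.

Lemma minimals_neq0 A : A != set0 -> minimals A != set0.
Proof.
case/set0Pn => u uA.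
case: (arg_minnP (fun v => #|[set w | (w < v)%O]|) uA) => m mA min_m.
apply/set0Pn; exists m; apply/minimalsP; split=> // v vA; apply/negP => lt_vm.
have := min_m v vA; rewrite leqNgt => /negP; apply; apply: proper_card.
apply/properP; split; last by exists v; rewrite !inE ?lt_vm ?ltxx.
by apply/subsetP => w; rewrite !inE => /lt_trans->.
Qed.

Lemma upsetP A :
  reflect (forall u v, u \in A -> (u < v)%O -> v \in A) (upset A).
Proof.
apply: (iffP forall_inP) => [upA u v /upA/forallP/(_ v)/implyP //|upA u uA].
by apply/forallP => v; apply/implyP; apply: upA.
Qed.

Lemma upsetT : upset setT.
Proof. by apply/upsetP => u v; rewrite !inE. Qed.

Lemma upsetU A B : upset A -> upset B -> upset (A :|: B).
Proof.
move=> /upsetP upA /upsetP upB; apply/upsetP => u v /setUP[] uAB lt_uv.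
  by rewrite inE (upA u).
by rewrite inE (upB u) ?orbT.
Qed.

Lemma upsetI A B : upset A -> upset B -> upset (A :&: B).
Proof.
move=> /upsetP upA /upsetP upB; apply/upsetP => u v /setIP[uA uB] lt_uv.
by rewrite inE (upA u) // (upB u).
Qed.

Lemma upset_setD1 A m : upset A -> m \in minimals A -> upset (A :\ m).
Proof.
move=> /upsetP upA /minimalsP[_ min_m].
apply/upsetP => u v /setD1P[um uA] lt_uv.
by rewrite !inE (upA u) // andbT; apply: contraTneq lt_uv => ->; apply: min_m.
Qed.

Lemma upset_proper_sub_setD1 A U : upset U -> U \proper A ->
  exists2 m, m \in minimals A & U \subset A :\ m.
Proof.
move=> /upsetP upU /properP[UA [w wA wU]].
have /minimals_neq0/set0Pn[m /minimalsP[/setDP[mA mU] min_m]] : A :\: U != set0.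
  by apply/set0Pn; exists w; rewrite inE wU.
exists m; last by rewrite subsetD1 UA.
apply/minimalsP; split=> // v vA; have [vU|vU] := boolP (v \in U).
  by apply: contra mU; apply: upU.
by apply: min_m; rewrite inE vU.
Qed.

Definition linexts A : seq (seq T) :=
  [seq s <- permutations (enum A) | pairwise (fun u v => ~~ (v < u)%O) s].

Lemma mem_linexts A s :
  (s \in linexts A) =
  pairwise (fun u v => ~~ (v < u)%O) s && perm_eq s (enum A).
Proof. by rewrite mem_filter mem_permutations. Qed.

Lemma linexts_uniq A : uniq (linexts A).
Proof. by rewrite filter_uniq // permutations_uniq. Qed.

Lemma cons_linexts A m s :
  (m :: s \in linexts A) = (m \in minimals A) && (s \in linexts (A :\ m)).
Proof.
rewrite !mem_linexts /= inE.
have [mA|mA] := boolP (m \in A); last first.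
  rewrite andbC; apply/andP => -[/perm_mem/(_ m)].
  by rewrite mem_enum (negPf mA) mem_head.
have /permPr -> : perm_eq (enum A) (m :: enum (A :\ m)).
  apply: uniq_perm; rewrite /= ?enum_uniq ?mem_enum ?setD11 // => v.
  by rewrite inE !mem_enum !inE; case: eqVneq => // ->.
rewrite perm_cons; case perm_s: (perm_eq _ _); rewrite ?andbF // !andbT.
congr (_ && _); rewrite (eq_all_r (perm_mem perm_s)).
apply/allP/forall_inP => min_m v; last first.
  by rewrite mem_enum => /setD1P[_ /min_m].
move=> vA; have [->|vm] := eqVneq v m; first by rewrite ltxx.
by apply: min_m; rewrite mem_enum !inE vm.
Qed.

Lemma perm_linexts A : A != set0 ->
  perm_eq (linexts A)
          [seq m :: s | m <- enum (minimals A), s <- linexts (A :\ m)].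
Proof.
move=> A_neq0; apply: uniq_perm; first exact: linexts_uniq.
  apply: allpairs_uniq_dep => [|m _|]; rewrite ?enum_uniq ?linexts_uniq //.
  by move=> [m s] [m' s'] /= _ _ [-> ->].
case=> [|m s].
  rewrite mem_linexts /=; apply/idP/allpairsPdep => [/perm_size|[m [s []]]] //.
  by rewrite -cardE => /esym/eqP; rewrite cards_eq0 (negPf A_neq0).
rewrite cons_linexts; apply/andP/allpairsPdep => [[mA sA]|].
  by exists m, s; rewrite mem_enum.
by move=> [m' [s' [+ sA [-> ->]]]]; rewrite mem_enum.
Qed.

Lemma big_linexts (R : Type) (idx : R) (op : Monoid.com_law idx) A
    (F : seq T -> R) : A != set0 ->
  \big[op/idx]_(s <- linexts A) F s =
  \big[op/idx]_(m in minimals A)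
    \big[op/idx]_(s <- linexts (A :\ m)) F (m :: s).
Proof.
move=> A_neq0.
by rewrite (perm_big _ (perm_linexts A_neq0)) big_allpairs_dep big_enum.
Qed.

Definition nb_linexts A := size (linexts A).

Lemma nb_linexts0 : nb_linexts set0 = 1.
Proof. by rewrite /nb_linexts /linexts enum_set0. Qed.

Lemma nb_linextsE A : A != set0 ->
  nb_linexts A = \sum_(m in minimals A) nb_linexts (A :\ m).
Proof.
move=> A_neq0; rewrite /nb_linexts -sum1_size big_linexts //.
by apply: eq_bigr => m _; rewrite sum1_size.
Qed.

Lemma nb_linexts_gt0 A : 0 < nb_linexts A.
Proof.
elim/setD1_ind: A => A IHA; have [->|A_neq0] := eqVneq A set0.
  by rewrite nb_linexts0.
have /set0Pn[m mA] := minimals_neq0 A_neq0.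
by rewrite nb_linextsE // (bigD1 m) //= ltn_addr // IHA // (minimals_sub mA).
Qed.

(* For an up-set [A], the number of order-preserving maps from [A] to a chain of
   [N] elements; [U] is the set of elements not sent to the bottom. *)
Fixpoint order_poly N A :=
  if N is N'.+1 then
    \sum_(U : {set T} | upset U && (U \subset A)) order_poly N' U
  else (A == set0) : nat.

Lemma order_poly_supermodular N A B : upset A -> upset B ->
  order_poly N A * order_poly N B <=
  order_poly N (A :|: B) * order_poly N (A :&: B).
Proof.
elim: N A B => [|N IHN] A B upA upB /=.
  rewrite !mulnb setU_eq0; case: andP => //= -[/eqP-> _].
  by rewrite set0I eqxx.
pose weight S U := (upset U && (U \subset S)) * order_poly N U.
have sumE S : ((\sum_(U : {set T} | upset U && (U \subset S)) order_poly N U)%:R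
    = \sum_(U : {set T} | U \subset setT) (weight S U)%:R :> int)%R.
  rewrite -natr_sum big_mkcond [in RHS]big_mkcond; congr _%:R%R.
  by apply: eq_bigr => U _; rewrite subsetT /weight; case: ifP; rewrite ?mul1n.
rewrite -(ler_nat int) !natrM !sumE; apply: Ahlswede_Daykin => // U V _ _.
rewrite -!natrM ler_nat /weight.
case: andP => // -[upU UA]; case: andP => [[upV VB]|_]; last by rewrite muln0.
by rewrite !mul1n upsetU // upsetI // setUSS // setISS // !mul1n IHN.
Qed.

Lemma order_poly0 N : order_poly N set0 = 1.
Proof.
elim: N => [|N IHN] /=; first by rewrite eqxx.
rewrite (big_pred1 set0) // => U; rewrite subset0.
by apply: andb_idl => /eqP->; apply/upsetP => u v; rewrite inE.
Qed.

Lemma order_polyS_ge N A : upset A ->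
  order_poly N A + \sum_(m in minimals A) order_poly N (A :\ m)
  <= order_poly N.+1 A.
Proof.
move=> upA /=; rewrite (bigD1 A) ?upA ?subxx //= leq_add2l.
have setD1_inj : {in minimals A &, injective (fun m => A :\ m)}.
  move=> m m' /minimals_sub mA _ eqA; apply: contraTeq mA => neq_m.
  by have := setD11 m A; rewrite eqA !inE neq_m /= => ->.
rewrite -(big_imset (order_poly N) setD1_inj) /=.
apply: (sub_le_big leqnn (fun i j => leq_addr j i)) => U /imsetP[m mA ->].
rewrite upset_setD1 // subD1set /=; apply/eqP => eqA.
by have := minimals_sub mA; rewrite -eqA setD11.
Qed.

Lemma order_polyS_le N A : upset A ->
  order_poly N.+1 A <=
  order_poly N A + \sum_(m in minimals A) order_poly N.+1 (A :\ m).
Proof.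
move=> upA; rewrite /= (bigD1 A) ?upA ?subxx //= leq_add2l.
rewrite (exchange_big_dep upset) => [|m U mA /andP[] //].
under eq_bigl => U do rewrite -andbA [(U \subset A) && _]andbC -properEneq.
rewrite big_mkcondr; apply: leq_sum => U upU; case: ifP => // UA.
have [m mA UAm] := upset_proper_sub_setD1 upU UA.
by rewrite (bigD1 m) ?mA ?upU //= leq_addr.
Qed.

Lemma order_poly_ge N A : upset A ->
  'C(N, #|A|) * nb_linexts A <= order_poly N A.
Proof.
elim: N A => [|N IHN] A upA.
  by rewrite /= bin0n cards_eq0; case: eqP => // ->; rewrite nb_linexts0.
case cardA: #|A| => [|k].
  by rewrite (cards0_eq cardA) nb_linexts0 bin0 order_poly0.
apply: leq_trans (order_polyS_ge N upA).
rewrite binS mulnDl leq_add //; first by rewrite -cardA IHN.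
rewrite nb_linextsE -?card_gt0 ?cardA // big_distrr; apply: leq_sum => m mA /=.
by rewrite -(card_setD1_minimals cardA mA) IHN // upset_setD1.
Qed.

Lemma order_poly_le N A : upset A ->
  order_poly N A <= 'C(N + #|A|, #|A|) * nb_linexts A.
Proof.
elim: N A => [|N IHN] A.
  by rewrite /=; case: eqP => // ->; rewrite cards0 bin0 nb_linexts0.
elim/setD1_ind: A => A IHA upA.
case cardA: #|A| => [|k].
  by rewrite (cards0_eq cardA) nb_linexts0 bin0 order_poly0.
apply: leq_trans (order_polyS_le N upA) _.
rewrite addnS binS mulnDl leq_add //; first by rewrite addSn -addnS -cardA IHN.
rewrite nb_linextsE -?card_gt0 ?cardA // big_distrr; apply: leq_sum => m mA /=.
rewrite -(card_setD1_minimals cardA mA).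
exact: IHA (minimals_sub mA) (upset_setD1 upA mA).
Qed.

Lemma order_poly_exp_ge M k A : upset A -> #|A| <= k ->
  nb_linexts A * M ^ #|A| <= order_poly (M + k) A * #|A|`!.
Proof.
move=> upA leAk; apply: leq_trans (leq_mul (order_poly_ge _ upA) (leqnn _)).
by rewrite mulnAC bin_ffact mulnC leq_mul // leq_expn_ffact.
Qed.

Lemma order_poly_exp_le M k A : upset A -> #|A| <= k ->
  order_poly (M + k) A * #|A|`! <= nb_linexts A * (M + k.*2) ^ #|A|.
Proof.
move=> upA leAk; apply: leq_trans (leq_mul (order_poly_le _ upA) (leqnn _)) _.
rewrite mulnAC bin_ffact mulnC leq_mul // (leq_trans (leq_ffact_expn _ _)) //.
by rewrite leq_exp2rW // -addnn addnA leq_add2l.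
Qed.

(* Compares the leading coefficients of the order polynomials of the four
   up-sets. *)
Theorem nb_linexts_Fishburn A B : upset A -> upset B ->
  nb_linexts A * nb_linexts B * (#|A :|: B|`! * #|A :&: B|`!) <=
  nb_linexts (A :|: B) * nb_linexts (A :&: B) * (#|A|`! * #|B|`!).
Proof.
move=> upA upB; have [upU upI] := (upsetU upA upB, upsetI upA upB).
pose k := #|A| + #|B|.
have cardUI : #|A :|: B| + #|A :&: B| = k by apply: cardsUI.
have [leA leB] : #|A| <= k /\ #|B| <= k by rewrite leq_addr leq_addl.
have [leU leI] : #|A :|: B| <= k /\ #|A :&: B| <= k.
  by rewrite -cardUI leq_addr leq_addl.
apply: (@leq_of_leq_mul_expn _ _ k.*2 k) => M.
have := leq_mul (order_poly_exp_ge M upA leA) (order_poly_exp_ge M upB leB).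
have := leq_mul (order_poly_exp_le M upU leU) (order_poly_exp_le M upI leI).
rewrite mulnACA [leqRHS]mulnACA -expnD cardUI => le_upper.
rewrite mulnACA -expnD [leqRHS]mulnACA => le_lower.
rewrite mulnAC (leq_trans (leq_mul le_lower (leqnn _))) //.
rewrite [leqRHS]mulnAC; apply: leq_trans (leq_mul le_upper (leqnn _)).
by rewrite mulnAC leq_mul // leq_mul // order_poly_supermodular.
Qed.

Corollary nb_linexts_supermodular A B : upset A -> upset B ->
  nb_linexts A * nb_linexts B <= nb_linexts (A :|: B) * nb_linexts (A :&: B).
Proof.
move=> upA upB.
have fact2_gt0 i j : 0 < i`! * j`! by rewrite muln_gt0 !fact_gt0.
rewrite -(leq_pmul2r (fact2_gt0 #|A :|: B| #|A :&: B|)).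
apply: leq_trans (nb_linexts_Fishburn upA upB) _; rewrite leq_mul //.
have cardA := cardsID B A; have cardB := cardsID A B.
have := cardsUI A B; rewrite -cardA -cardB [B :&: A]setIC => cardU.
have -> : #|A :|: B| = #|A :&: B| + #|A :\: B| + #|B :\: A| by lia.
exact: leq_mul_fact.
Qed.

Corollary nb_linexts_setD1 A a b : upset A ->
    a \in minimals A -> b \in minimals A -> a != b ->
  nb_linexts (A :\ a) * nb_linexts (A :\ b) <=
  nb_linexts A * nb_linexts (A :\ a :\ b).
Proof.
move=> upA aA bA neq_ab.
have := nb_linexts_supermodular (upset_setD1 upA aA) (upset_setD1 upA bA).
have -> : A :\ a :|: A :\ b = A.
  rewrite -setDIr (_ : [set a] :&: [set b] = set0) ?setD0 //.
  by apply/eqP; rewrite setI_eq0 disjoints1 inE.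
by rewrite setDDl setDUr.
Qed.

(** * Log-concavity of the rising moments *)

(* The number of linear extensions of [A] enlarged by a chain of [j] elements
   below [x]: a multiset of [j] of the [index x s + 1] slots before [x]. *)
Definition rising_moment x j A := \sum_(s <- linexts A) 'C(index x s + j, j).

Lemma rising_moment0 x A : rising_moment x 0 A = nb_linexts A.
Proof.
rewrite /rising_moment /nb_linexts -sum1_size.
by apply: eq_bigr => s _; rewrite bin0.
Qed.

Lemma rising_moment_gt0 x j A : 0 < rising_moment x j A.
Proof.
rewrite (leq_trans (nb_linexts_gt0 A)) // -(rising_moment0 x).
by apply: leq_sum => s _; rewrite bin0 bin_gt0 leq_addl.
Qed.

Lemma rising_momentS x j A : x \in A ->
  rising_moment x j.+1 A =
  rising_moment x j A
  + \sum_(m in minimals A | m != x) rising_moment x j.+1 (A :\ m).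
Proof.
move=> xA; have A_neq0 : A != set0 by apply/set0Pn; exists x.
rewrite /rising_moment !big_linexts // big_mkcondr -big_split /=.
apply: eq_bigr => m _; have [->|mx] /= := eqVneq m x.
  by rewrite addn0; apply: eq_bigr => s _; rewrite !add0n !binn.
rewrite -big_split; apply: eq_bigr => s _ /=.
by rewrite addnS binS addSnnS addnC.
Qed.

Lemma minimals_setD1_cover x z A : (forall v, (z < v)%O = (x <= v)%O) ->
    z \in minimals A -> x \in A ->
  forall m, (m \in minimals A) && (m != z) =
            (m \in minimals (A :\ z)) && (m != x).
Proof.
move=> zE /minimalsP[zA _] xA m; have lt_zx : (z < x)%O by rewrite zE.
apply/andP/andP => [[/minimalsP[mA min_m] mz]|].
  split; last by apply: contraTneq lt_zx => <-; apply: min_m.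
  by apply/minimalsP; split=> [|v /setD1P[_ /min_m]]; rewrite ?in_setD1 ?mz.
move=> [/minimalsP[/setD1P[mz mA] min_m] mx].
split=> //; apply/minimalsP; split=> // v vA.
have [->|vz] := eqVneq v z; last by rewrite min_m // in_setD1 vz.
by rewrite zE le_eqVlt eq_sym (negPf mx) min_m // in_setD1 xA gt_eqF.
Qed.

Lemma rising_moment_cover x z j A : (forall v, (z < v)%O = (x <= v)%O) ->
    z \in minimals A -> x \in A ->
  rising_moment z j A = rising_moment x j.+1 (A :\ z).
Proof.
move=> zE; elim/setD1_ind: A j => A IHA j zA xA.
have xz : x != z by rewrite gt_eqF // zE.
have xAz : x \in A :\ z by rewrite in_setD1 xz.
have minE := minimals_setD1_cover zE zA xA.
have sumE k :
    \sum_(m in minimals (A :\ z) | m != x) rising_moment x k.+1 (A :\ z :\ m) =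
    \sum_(m in minimals A | m != z) rising_moment z k (A :\ m).
  apply: eq_big => m; rewrite -minE // => min_m; rewrite setD1C.
  have /andP[mA mz] := min_m; have xm : x != m.
    by move: min_m; rewrite minE eq_sym => /andP[].
  apply/esym/IHA; first exact: minimals_sub mA.
    by rewrite minimals_setD1 // eq_sym.
  by rewrite in_setD1 xm.
elim: j => [|j IHj]; rewrite (rising_momentS _ xAz) sumE.
  rewrite !rising_moment0 nb_linextsE; last by apply/set0Pn; exists x.
  rewrite (bigD1 z) //=; congr (_ + _).
  by apply: eq_bigr => m _; rewrite rising_moment0.
by rewrite (rising_momentS _ (minimals_sub zA)) IHj.
Qed.

End LinearExtensions.

Section Embedding.

Variables (d d' : Order.disp_t) (T : finPOrderType d) (T' : finPOrderType d').
Variable f : T -> T'.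
Hypothesis f_mono : {mono f : u v / (u <= v)%O}.
Implicit Types (A : {set T}).

Lemma minimals_imset A : minimals (f @: A) = f @: minimals A.
Proof.
have f_inj := inc_inj f_mono; have f_lt := leW_mono f_mono.
apply/setP => y; apply/minimalsP/imsetP => [[/imsetP[m mA ->] min_m]|].
  exists m => //; apply/minimalsP; split=> // v vA.
  by rewrite -f_lt min_m // imset_f.
case=> m /minimalsP[mA min_m] ->; split; first exact: imset_f.
by move=> _ /imsetP[v vA ->]; rewrite f_lt min_m.
Qed.

Lemma big_linexts_imset (R : Type) (idx : R) (op : Monoid.com_law idx) A
    (F : seq T' -> R) :
  \big[op/idx]_(s <- linexts (f @: A)) F s =
  \big[op/idx]_(s <- linexts A) F (map f s).
Proof.
have f_inj := inc_inj f_mono.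
elim/setD1_ind: A F => A IHA F; have [->|A_neq0] := eqVneq A set0.
  by rewrite imset0 /linexts !enum_set0 !big_seq1.
rewrite !big_linexts ?imset_eq0 // minimals_imset.
rewrite big_imset /=; last exact: in2W.
apply: eq_bigr => m mA.
by rewrite -(IHA _ (minimals_sub mA) (fun s => F (f m :: s))) imset_setD1.
Qed.

Lemma rising_moment_imset x j A :
  rising_moment (f x) j (f @: A) = rising_moment x j A.
Proof.
rewrite /rising_moment big_linexts_imset.
by apply: eq_bigr => s _; rewrite index_map //; apply: inc_inj.
Qed.

End Embedding.

(* [T] with a new minimal element [None] whose only upper cover is [x]. *)
Definition point_below (d : Order.disp_t) (T : finPOrderType d) (x : T) :
  Type := option T.

Section PointBelow.

Variables (d : Order.disp_t) (T : finPOrderType d) (x : T).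
Implicit Types (A : {set T}).

HB.instance Definition _ := Finite.on (point_below x).

Definition point_below_le : rel (point_below x) := fun p q =>
  match p, q with
  | Some u, Some v => (u <= v)%O
  | None, Some v => (x <= v)%O
  | Some _, None => false
  | None, None => true
  end.

Lemma point_below_le_refl : reflexive point_below_le.
Proof. by case=> /=. Qed.

Lemma point_below_le_anti : antisymmetric point_below_le.
Proof. by case=> [u|] [v|]; rewrite /= ?andbF // => /le_anti->. Qed.

Lemma point_below_le_trans : transitive point_below_le.
Proof. by case=> [v|] [u|] [w|] //=; apply: le_trans. Qed.

HB.instance Definition _ := Order.Le_isPOrder.Build d (point_below x)
  point_below_le_refl point_below_le_anti point_below_le_trans.

Definition new_point : point_below x := None.

Definition old_point (u : T) : point_below x := Some u.

Definition add_point_below A : {set point_below x} :=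
  new_point |: old_point @: A.

Lemma le_old_point : {mono old_point : u v / (u <= v)%O}.
Proof. by []. Qed.

Lemma lt_old_point : {mono old_point : u v / (u < v)%O}.
Proof. exact: leW_mono le_old_point. Qed.

Lemma old_point_inj : injective old_point.
Proof. exact: inc_inj le_old_point. Qed.

Lemma lt_new_point p : (new_point < p)%O = (old_point x <= p)%O.
Proof. by rewrite lt_leAnge; case: p => //= v; apply: andbT. Qed.

Lemma new_point_notin_imset A : new_point \notin old_point @: A.
Proof. by apply/imsetP => -[]. Qed.

Lemma add_point_below_setD1_new A :
  add_point_below A :\ new_point = old_point @: A.
Proof. by rewrite setU1K // new_point_notin_imset. Qed.

Lemma add_point_below_setD1_old A m :
  add_point_below A :\ old_point m = add_point_below (A :\ m).
Proof.
rewrite /add_point_below (imset_setD1 _ _ old_point_inj) setDUl.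
suff -> : [set new_point] :\ old_point m = [set new_point] by [].
by apply/setP => -[v|]; rewrite !inE ?andbF.
Qed.

Lemma minimals_new_point A : new_point \in minimals (add_point_below A).
Proof. by apply/minimalsP; split=> [|[]//]; rewrite !inE. Qed.

Lemma minimals_old_point A m : x \in A -> m \in minimals A -> m != x ->
  old_point m \in minimals (add_point_below A).
Proof.
move=> xA /minimalsP[mA min_m] mx; apply/minimalsP; split.
  by rewrite !inE imset_f.
move=> p /setU1P[->|/imsetP[v vA ->]]; last by rewrite lt_old_point min_m.
by rewrite lt_new_point le_old_point le_eqVlt negb_or eq_sym mx min_m.
Qed.

Lemma upset_add_point_below A : x \in A -> upset A -> upset (add_point_below A).
Proof.
move=> xA /upsetP upA; apply/upsetP => p [v|]; last by case: p.
rewrite -/(old_point v) => p_in lt_pv.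
rewrite !inE mem_imset; last exact: old_point_inj.
case/setU1P: p_in lt_pv => [->|/imsetP[u uA ->]]; last first.
  by rewrite lt_old_point => /upA->.
by rewrite lt_new_point le_old_point le_eqVlt => /predU1P[<-|/upA->].
Qed.

Lemma rising_moment_add_point_below j A : x \in A ->
  rising_moment new_point j (add_point_below A) = rising_moment x j.+1 A.
Proof.
move=> xA; rewrite (rising_moment_cover _ lt_new_point) ?minimals_new_point //.
  by rewrite add_point_below_setD1_new (rising_moment_imset le_old_point).
by rewrite !inE imset_f.
Qed.

Lemma rising_moment1_setD1 A m :
    upset A -> x \in A -> m \in minimals A -> m != x ->
  rising_moment x 1 (A :\ m) * nb_linexts A <=
  rising_moment x 1 A * nb_linexts (A :\ m).
Proof.
move=> upA xA mA mx; have xAm : x \in A :\ m by rewrite in_setD1 eq_sym mx.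
have nbE B : nb_linexts B = nb_linexts (add_point_below B :\ new_point).
  rewrite add_point_below_setD1_new -(rising_moment0 x).
  by rewrite -(rising_moment_imset le_old_point) rising_moment0.
rewrite -!rising_moment_add_point_below // !rising_moment0.
rewrite (nbE A) (nbE (A :\ m)) -add_point_below_setD1_old.
apply: nb_linexts_setD1 => //.
- exact: upset_add_point_below.
- exact: minimals_old_point.
- exact: minimals_new_point.
Qed.

End PointBelow.

Lemma rising_moment_setD1 j (d : Order.disp_t) (T : finPOrderType d) (x : T)
    (A : {set T}) m :
    upset A -> x \in A -> m \in minimals A -> m != x ->
  rising_moment x j.+1 (A :\ m) * rising_moment x j A <=
  rising_moment x j.+1 A * rising_moment x j (A :\ m).
Proof.
elim: j d T x A m => [|j IHj] d T x A m upA xA mA mx.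
  by rewrite !rising_moment0 rising_moment1_setD1.
have xAm : x \in A :\ m by rewrite in_setD1 eq_sym mx.
have := IHj _ _ (new_point x) _ _ (upset_add_point_below xA upA) _
  (minimals_old_point xA mA mx).
rewrite add_point_below_setD1_old !rising_moment_add_point_below //.
by apply=> //; rewrite !inE.
Qed.

Theorem rising_moment_log_concave (d : Order.disp_t) (T : finPOrderType d)
    (x : T) j (A : {set T}) : upset A -> x \in A ->
  rising_moment x j.+2 A * rising_moment x j A <= rising_moment x j.+1 A ^ 2.
Proof.
elim/setD1_ind: A => A IHA upA xA.
rewrite rising_momentS // mulnDl -mulnn [X in _ <= X * _]rising_momentS //.
rewrite mulnDl [X in _ <= X + _]mulnC leq_add2l !big_distrl.
apply: leq_sum => m /andP[mA mx] /=.
have xAm : x \in A :\ m by rewrite in_setD1 eq_sym mx.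
rewrite -(leq_pmul2r (rising_moment_gt0 x j (A :\ m))) mulnAC.
have {}IHA := IHA m (minimals_sub mA) (upset_setD1 upA mA) xAm.
rewrite (leq_trans (leq_mul IHA (leqnn _))) //.
by rewrite -mulnn -!mulnA leq_mul // rising_moment_setD1.
Qed.

(** * Uniformly random linear extensions *)

Section FiniteFunctions.

Variables (d : Order.disp_t) (X : finPOrderType d).
Implicit Types (s t : seq X) (u v x : X) (g : {ffun X -> 'I_#|X|}).

Lemma perm_linextsT s : s \in linexts setT -> perm_eq s (enum X).
Proof. by rewrite mem_linexts enum_setT -enumT => /andP[]. Qed.

Lemma linextsT_mem s u : s \in linexts setT -> u \in s.
Proof. by move=> /perm_linextsT/perm_mem->; rewrite mem_enum. Qed.

Lemma linextsT_uniq s : s \in linexts setT -> uniq s.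
Proof. by move=> /perm_linextsT/perm_uniq->; apply: enum_uniq. Qed.

Lemma linextsT_size s : s \in linexts setT -> size s = #|X|.
Proof. by move=> /perm_linextsT/perm_size->; rewrite -cardE. Qed.

Lemma linextsT_index_inj s : s \in linexts setT -> injective (index^~ s).
Proof.
move=> sL u v eq_uv.
by rewrite -(nth_index u (linextsT_mem u sL)) eq_uv nth_index ?linextsT_mem.
Qed.

Lemma linextsT_index_lt s u v : s \in linexts setT ->
  (u < v)%O -> index u s < index v s.
Proof.
move=> sL lt_uv; have [us vs] := (linextsT_mem u sL, linextsT_mem v sL).
have := sL; rewrite mem_linexts => /andP[/(pairwiseP u) sorted_s _].
case: ltngtP => // [lt_vu|/(linextsT_index_inj sL) eq_uv].
  have := sorted_s _ _ _ _ lt_vu; rewrite !inE !index_mem => /(_ vs us).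
  by rewrite !nth_index // lt_uv.
by rewrite eq_uv ltxx in lt_uv.
Qed.

(* The default [i0] is irrelevant for the elements of [linexts setT]. *)
Definition ext_of_seq (i0 : 'I_#|X|) s : {ffun X -> 'I_#|X|} :=
  [ffun u => insubd i0 (index u s)].

Lemma ext_of_seqE i0 s u : s \in linexts setT ->
  ext_of_seq i0 s u = index u s :> nat.
Proof.
move=> sL; have lt_u : index u s < #|X|.
  by rewrite -(linextsT_size sL) index_mem linextsT_mem.
by rewrite ffunE val_insubd lt_u.
Qed.

Lemma ext_of_seq_inj i0 : {in linexts setT &, injective (ext_of_seq i0)}.
Proof.
move=> s t sL tL /ffunP eq_st.
have eq_index u : index u s = index u t.
  by rewrite -(ext_of_seqE i0 u sL) eq_st ext_of_seqE.
have size_st : size s = size t by rewrite !linextsT_size.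
case def_s: s => [|x s']; first by rewrite def_s in size_st; case: (t) size_st.
rewrite -def_s; apply: (@eq_from_nth _ x) => // i lt_i.
rewrite -{2}(index_uniq x lt_i (linextsT_uniq sL)) eq_index.
by rewrite nth_index ?linextsT_mem.
Qed.

Lemma ext_of_seq_linear i0 s :
  s \in linexts setT -> ext_of_seq i0 s \in linear_extensions X.
Proof.
move=> sL; have inj_g : injective (ext_of_seq i0 s).
  move=> u v /(congr1 val) /=; rewrite !ext_of_seqE //.
  exact: linextsT_index_inj.
rewrite inE; apply/and3P; split; first exact/injectiveP.
  apply/forallP => i; apply/existsP.
  have /codomP[u ->] : i \in codom (ext_of_seq i0 s).
    by rewrite inj_card_onto ?card_ord.
  by exists u.
apply/'forall_'forall_implyP => u v.
by rewrite !ext_of_seqE //; apply: linextsT_index_lt.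
Qed.

Lemma ext_of_seq_surj i0 g : g \in linear_extensions X ->
  exists2 s, s \in linexts setT & g = ext_of_seq i0 s.
Proof.
rewrite inE => /and3P[/injectiveP inj_g _ /'forall_'forall_implyP g_lt].
have [h gK hK] : bijective g by apply: inj_card_bij; rewrite ?card_ord.
have inj_h := can_inj hK; pose s := [seq h i | i <- enum 'I_#|X|].
have sL : s \in linexts setT.
  rewrite mem_linexts; apply/andP; split; last first.
    apply: uniq_perm; rewrite ?(map_inj_uniq inj_h) ?enum_uniq //.
    by move=> u; rewrite mem_enum inE -(gK u) map_f // mem_enum.
  rewrite /s pairwise_map; apply/(pairwiseP i0) => i j.
  rewrite !inE !size_enum_ord => lt_i lt_j lt_ij.
  apply: contraTN lt_ij => /g_lt; rewrite !hK !nth_enum_ord //.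
  by rewrite -leqNgt => /ltnW.
exists s => //; apply/ffunP => u; apply: val_inj; rewrite /= ext_of_seqE //.
by rewrite -{2}(gK u) index_map // index_enum_ord.
Qed.

Lemma big_linear_extensions (R : Type) (idx : R) (op : Monoid.com_law idx)
    (F : nat -> R) x :
  \big[op/idx]_(g in linear_extensions X) F (g x) =
  \big[op/idx]_(s <- linexts setT) F (index x s).
Proof.
pose i0 := enum_rank x.
rewrite -big_enum (perm_big [seq ext_of_seq i0 s | s <- linexts setT]) /=.
  rewrite big_map big_seq [RHS]big_seq.
  by apply: eq_bigr => s sL; rewrite ext_of_seqE.
apply: uniq_perm; first exact: enum_uniq.
  by rewrite (map_inj_in_uniq (@ext_of_seq_inj i0)) linexts_uniq.
move=> g; rewrite mem_enum.
apply/idP/mapP => [/(ext_of_seq_surj i0)|] [s sL ->].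
  by exists s.
exact: ext_of_seq_linear.
Qed.

Lemma card_linear_extensions (x : X) :
  #|linear_extensions X| = nb_linexts [set: X].
Proof.
by rewrite -sum1_card (big_linear_extensions _ (fun=> 1) x) sum1_size.
Qed.

End FiniteFunctions.

Local Open Scope ring_scope.

Section Expectation.

Variables (R : realFieldType) (d : Order.disp_t) (X : finPOrderType d).
Implicit Types (F G : {ffun X -> 'I_#|X|} -> R) (c u v : R) (x y : X).

Lemma eq_lext_expect F G : F =1 G -> lext_expect F = lext_expect G.
Proof. by move=> eqFG; rewrite /lext_expect (eq_bigr G). Qed.

Lemma lext_expectD F G :
  lext_expect (fun f => F f + G f) = lext_expect F + lext_expect G.
Proof. by rewrite /lext_expect big_split mulrDl. Qed.

Lemma lext_expectZ c F : lext_expect (fun f => c * F f) = c * lext_expect F.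
Proof. by rewrite /lext_expect -mulr_sumr mulrA. Qed.

Lemma ler_lext_expect F G :
  (forall f, F f <= G f) -> lext_expect F <= lext_expect G.
Proof. by move=> leFG; rewrite ler_wpM2r ?invr_ge0 // ler_sum. Qed.

Lemma lext_expect_bin x j :
  lext_expect (fun f => 'C(f x + j, j)%:R : R) =
  (rising_moment x j setT)%:R / (nb_linexts [set: X])%:R.
Proof.
rewrite /lext_expect -natr_sum.
rewrite (big_linear_extensions _ (fun i => 'C(i + j, j))).
by rewrite (card_linear_extensions x).
Qed.

Lemma lext_expect_bin_gt0 x j :
  0 < lext_expect (fun f => 'C(f x + j, j)%:R : R).
Proof.
rewrite lext_expect_bin divr_gt0 // ltr0n; first exact: rising_moment_gt0.
exact: nb_linexts_gt0.
Qed.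

Lemma lext_expect_bin_log_concave x j :
  lext_expect (fun f => 'C(f x + j.+2, j.+2)%:R : R)
    * lext_expect (fun f => 'C(f x + j, j)%:R)
  <= lext_expect (fun f => 'C(f x + j.+1, j.+1)%:R) ^+ 2.
Proof.
rewrite !lext_expect_bin mulrACA expr_div_n -invfM -expr2.
rewrite ler_wpM2r ?invr_ge0 ?exprn_ge0 // -natrM -natrX ler_nat.
by rewrite rising_moment_log_concave ?upsetT ?inE.
Qed.

Lemma lext_expect_val_gt0 x : 0 < lext_expect (fun f => (lext_val f x)%:R : R).
Proof.
have := lext_expect_bin_gt0 x 1.
by under eq_lext_expect => f do rewrite bin1 addn1.
Qed.

Lemma lext_expect_val_bin2 x :
  lext_expect (fun f => 'C((lext_val f x).+1, 2)%:R : R)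
  <= lext_expect (fun f => (lext_val f x)%:R) ^+ 2.
Proof.
have := lext_expect_bin_log_concave x 0.
have -> : lext_expect (fun f => 'C(f x + 0, 0)%:R) = 1 :> R.
  rewrite lext_expect_bin rising_moment0 divff // pnatr_eq0 -lt0n.
  exact: nb_linexts_gt0.
rewrite mulr1; under [in X in _ <= X]eq_lext_expect => f do rewrite bin1 addn1.
by under eq_lext_expect => f do rewrite addn2.
Qed.

Lemma mul_min_weighted_AMGM (a b : nat) u v : 0 <= u -> 0 <= v ->
  u * v * (a%:R * b%:R + (minn a b)%:R) <=
  v ^+ 2 * 'C(a.+1, 2)%:R + u ^+ 2 * 'C(b.+1, 2)%:R.
Proof.
move=> u_ge0 v_ge0.
have bin2E n : 'C(n.+1, 2)%:R = n%:R * (n%:R + 1) / 2 :> R.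
  apply: (canRL (mulfK _)); first by rewrite pnatr_eq0.
  by rewrite -natrM mulnC -mul_bin_diag bin1 natrM mulrC -natr1.
have le_ma : (minn a b)%:R <= a%:R :> R by rewrite ler_nat geq_minl.
have le_mb : (minn a b)%:R <= b%:R :> R by rewrite ler_nat geq_minr.
have := sqr_ge0 (v * a%:R - u * b%:R).
have : 0 <= v ^+ 2 * (a%:R - (minn a b)%:R).
  by rewrite mulr_ge0 ?sqr_ge0 ?subr_ge0.
have : 0 <= u ^+ 2 * (b%:R - (minn a b)%:R).
  by rewrite mulr_ge0 ?sqr_ge0 ?subr_ge0.
have : 0 <= (u - v) ^+ 2 * (minn a b)%:R by rewrite mulr_ge0 ?sqr_ge0.
by rewrite !bin2E; lra.
Qed.

Lemma lext_expect_mul_min_leq x y u v : 0 <= u -> 0 <= v ->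
  u * v * (lext_expect (fun f => (lext_val f x)%:R * (lext_val f y)%:R)
           + lext_expect (fun f => (minn (lext_val f x) (lext_val f y))%:R))
  <= v ^+ 2 * lext_expect (fun f => 'C((lext_val f x).+1, 2)%:R)
     + u ^+ 2 * lext_expect (fun f => 'C((lext_val f y).+1, 2)%:R).
Proof.
move=> u_ge0 v_ge0; rewrite -lext_expectD -!lext_expectZ -lext_expectD.
by apply: ler_lext_expect => f; apply: mul_min_weighted_AMGM.
Qed.

End Expectation.

Theorem theorem1p2 (R : realFieldType) (d : Order.disp_t)
    (X : finPOrderType d) (x y : X) :
  (lext_expect (fun f => (lext_val f x)%:R * (lext_val f y)%:R : R)
   + lext_expect (fun f => (minn (lext_val f x) (lext_val f y))%:R : R))
  / (lext_expect (fun f => (lext_val f x)%:R : R)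
     * lext_expect (fun f => (lext_val f y)%:R : R))
  <= 2.
Proof.
have Ex_gt0 := lext_expect_val_gt0 R x; have Ey_gt0 := lext_expect_val_gt0 R y.
have le_Cx := lext_expect_val_bin2 R x; have le_Cy := lext_expect_val_bin2 R y.
have := lext_expect_mul_min_leq x y (ltW Ex_gt0) (ltW Ey_gt0).
set Ex := lext_expect _ in Ex_gt0 le_Cx *.
set Ey := lext_expect _ in Ey_gt0 le_Cy *.
move=> le_mul_min; have ExEy_gt0 : 0 < Ex * Ey by exact: mulr_gt0.
rewrite ler_pdivrMr // -(ler_pM2l ExEy_gt0) (le_trans le_mul_min) //.
have := ler_wpM2l (sqr_ge0 Ey) le_Cx; have := ler_wpM2l (sqr_ge0 Ex) le_Cy.
by lra.
Qed.
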